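(* Let $\mathbf{A}\in\mathbb{H}^{n\times n}$ and $\mathbf{B}\in\mathbb{H}^{m\times m}$ be Hermitian quaternion matrices with $\mathrm{Ind}\,\mathbf{A}=k_1$, $\mathrm{Ind}\,\mathbf{B}=k_2$, $\operatorname{rank}\mathbf{A}^{k_1+1}=\operatorname{rank}\mathbf{A}^{k_1}=r_1\le n$ and $\operatorname{rank}\mathbf{B}^{k_2+1}=\operatorname{rank}\mathbf{B}^{k_2}=r_2\le m$ (with $r_1,r_2\ge1$), and let $\mathbf{D}\in\mathbb{H}^{n\times m}$. Put $\widetilde{\mathbf{D}}=\mathbf{A}^{k_1}\mathbf{D}\mathbf{B}^{k_2}\in\mathbb{H}^{n\times m}$, with $l$th row $\widetilde{\mathbf{d}}_{l.}$ and $t$th column $\widetilde{\mathbf{d}}_{.t}$. Then for the Drazin inverse solution $\mathbf{X}=\mathbf{A}^{D}\mathbf{D}\mathbf{B}^{D}=(x_{ij})\in\mathbb{H}^{n\times m}$ of the matrix equation $\mathbf{A}\mathbf{X}\mathbf{B}=\mathbf{D}$ we have, for all $i=1,\dots,n$ and $j=1,\dots,m$, both $$x_{ij}=\frac{\sum_{\beta\in J_{r_1,n}\{i\}}\mathrm{cdet}_{i}\left(\left(\mathbf{A}^{k_1+1}\right)_{.i}\left(\mathbf{d}^{\mathbf{B}}_{.j}\right)\right)_{\beta}^{\beta}}{\sum_{\beta\in J_{r_1,n}}\left|\left(\mathbf{A}^{k_1+1}\right)_{\beta}^{\beta}\right|\;\sum_{\alpha\in I_{r_2,m}}\left|\left(\mathbf{B}^{k_2+1}\right)_{\alpha}^{\alpha}\right|}$$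 and $$x_{ij}=\frac{\sum_{\alpha\in I_{r_2,m}\{j\}}\mathrm{rdet}_{j}\left(\left(\mathbf{B}^{k_2+1}\right)_{j.}\left(\mathbf{d}^{\mathbf{A}}_{i.}\right)\right)_{\alpha}^{\alpha}}{\sum_{\beta\in J_{r_1,n}}\left|\left(\mathbf{A}^{k_1+1}\right)_{\beta}^{\beta}\right|\;\sum_{\alpha\in I_{r_2,m}}\left|\left(\mathbf{B}^{k_2+1}\right)_{\alpha}^{\alpha}\right|},$$ where $\mathbf{d}^{\mathbf{B}}_{.j}\in\mathbb{H}^{n\times1}$ is the column vector whose $l$th component ($l=1,\dots,n$) is $$\sum_{\alpha\in I_{r_2,m}\{j\}}\mathrm{rdet}_{j}\left(\left(\mathbf{B}^{k_2+1}\right)_{j.}\left(\widetilde{\mathbf{d}}_{l.}\right)\right)_{\alpha}^{\alpha},$$ and $\mathbf{d}^{\mathbf{A}}_{i.}\in\mathbb{H}^{1\times m}$ is the row vector whose $t$th component ($t=1,\dots,m$) is $$\sum_{\beta\in J_{r_1,n}\{i\}}\mathrm{cdet}_{i}\left(\left(\mathbf{A}^{k_1+1}\right)_{.i}\left(\widetilde{\mathbf{d}}_{.t}\right)\right)_{\beta}^{\beta}.$$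
   Context: $\mathbb{H}$ is the skew field of real quaternions; $\mathbf{A}^{*}$ is the conjugate transpose and $\mathbf{A}$ is Hermitian if $\mathbf{A}^*=\mathbf{A}$. The rank of a quaternion matrix is the maximal number of right-linearly independent columns (equivalently, of left-linearly independent rows). Index and Drazin inverse: $\mathrm{Ind}\,\mathbf{A}$ is the least integer $k\ge 0$ with $\operatorname{rank}\mathbf{A}^{k+1}=\operatorname{rank}\mathbf{A}^{k}$ ($\mathbf{A}^0=\mathbf{I}$). For $k=\mathrm{Ind}\,\mathbf{A}$, the Drazin inverse $\mathbf{A}^D$ is the unique matrix $\mathbf{X}$ with $\mathbf{A}^{k+1}\mathbf{X}=\mathbf{A}^{k}$, $\mathbf{X}\mathbf{A}\mathbf{X}=\mathbf{X}$, $\mathbf{A}\mathbf{X}=\mathbf{X}\mathbf{A}$. The ''Drazin inverse solution'' of $\mathbf{A}\mathbf{X}\mathbf{B}=\mathbf{D}$ is by definition the matrix $\mathbf{A}^D\mathbf{D}\mathbf{B}^D$. Row and column determinants of $\mathbf{M}=(m_{pq})\in\mathbb{H}^{n\times n}$: Row determinant: given $i$, write each permutation $\sigma\in S_n$ as a product of disjoint cycles (including cycles of length one) $C_1C_2\cdots C_r$, where $C_1$ is the cycle containing $i$ and is written starting with $i$, each $C_t$ with $t\ge2$ is written starting with its smallest element, and the first elements of $C_2,\dots,C_r$ are increasing. For a cycle $C=(c_0\,c_1\dots c_l)$ set $m_C=m_{c_0c_1}m_{c_1c_2}\cdots m_{c_lc_0}$. Then $\mathrm{rdet}_i\mathbf{M}=\sum_{\sigma\in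 S_n}(-1)^{n-r}m_{C_1}m_{C_2}\cdots m_{C_r}$, where $r=r(\sigma)$ is the number of cycles. Column determinant: given $j$, write each $\tau\in S_n$ as a product of disjoint cycles $C_r\cdots C_2C_1$, each written as $C=(c_l\dots c_1\,c_0)$, where $C_1$ contains $j$ and has $c_0=j$ as last element, each $C_t$ with $t\ge2$ has its smallest element $c_0$ last, and these last elements increase with $t=2,\dots,r$. Set $m'_C=m_{c_0c_l}m_{c_lc_{l-1}}\cdots m_{c_1c_0}$. Then $\mathrm{cdet}_j\mathbf{M}=\sum_{\tau\in S_n}(-1)^{n-r}m'_{C_r}\cdots m'_{C_2}m'_{C_1}$. For a Hermitian matrix all row and column determinants coincide and are real; their common value is the determinant $\det\mathbf{M}=|\mathbf{M}|$. Notation: $\mathbf{M}_{.i}(\mathbf{b})$ (resp. $\mathbf{M}_{j.}(\mathbf{b})$) is $\mathbf{M}$ with its $i$th column replaced by the column $\mathbf{b}$ (resp. its $j$th row replaced by the row $\mathbf{b}$). $\mathbf{M}_\beta^\beta$ is the principal submatrix with rows and columns indexed by $\beta$; its rows and columns keep their original labels, so $\mathrm{cdet}_i(\mathbf{M}_\beta^\beta)$ and $\mathrm{rdet}_i(\mathbf{M}_\beta^\beta)$ ($i\in\beta$) refer to the column/row originally labelled $i$. For $1\le s\le n$, $I_{s,n}=J_{s,n}$ is the set of all strictly increasing sequences (subsets) of $s$ integers from $\{1,\dots,n\}$, and $I_{s,n}\{i\}=J_{s,n}\{i\}$ is the subset of those containing $i$. *)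

(* Defs.v *)
From HB Require Import structures.
From mathcomp Require Import all_boot all_order all_fingroup all_algebra.
From mathcomp Require Import ring lra.
From mathcomp Require Import boolp reals.

Set Implicit Arguments.
Unset Strict Implicit.
Unset Printing Implicit Defensive.

Import Order.TTheory GRing.Theory Num.Theory.
Local Open Scope ring_scope.

Record quat (R : Type) := Quat { q0 : R; q1 : R; q2 : R; q3 : R }.

Section QuatType.
Variable R : Type.

Definition tuple_of_quat (x : quat R) := (q0 x, q1 x, q2 x, q3 x).

Definition quat_of_tuple (t : R * R * R * R) :=
  let: (a, b, c, d) := t in Quat a b c d.

Lemma tuple_of_quatK : cancel tuple_of_quat quat_of_tuple.
Proof. by case. Qed.

End QuatType.

HB.instance Definition _ (R : eqType) :=
  Equality.copy (quat R) (can_type (@tuple_of_quatK R)).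
HB.instance Definition _ (R : choiceType) :=
  Choice.copy (quat R) (can_type (@tuple_of_quatK R)).

Section QuatRing.
Variable R : realFieldType.
Implicit Types x y z : quat R.

Definition addq x y :=
  Quat (q0 x + q0 y) (q1 x + q1 y) (q2 x + q2 y) (q3 x + q3 y).

Definition oppq x := Quat (- q0 x) (- q1 x) (- q2 x) (- q3 x).

(* Hamilton's product: i^2 = j^2 = k^2 = ijk = -1. *)
Definition mulq x y := Quat
  (q0 x * q0 y - q1 x * q1 y - q2 x * q2 y - q3 x * q3 y)
  (q0 x * q1 y + q1 x * q0 y + q2 x * q3 y - q3 x * q2 y)
  (q0 x * q2 y - q1 x * q3 y + q2 x * q0 y + q3 x * q1 y)
  (q0 x * q3 y + q1 x * q2 y - q2 x * q1 y + q3 x * q0 y).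

Lemma addqA : associative addq.
Proof. by move=> [????] [????] [????]; rewrite /addq /= !addrA. Qed.

Lemma addqC : commutative addq.
Proof. by move=> [????] [????]; rewrite /addq /=; congr Quat; rewrite addrC. Qed.

Lemma add0q : left_id (Quat 0 0 0 0) addq.
Proof. by move=> [????]; rewrite /addq /= !add0r. Qed.

Lemma addNq : left_inverse (Quat 0 0 0 0) oppq addq.
Proof. by move=> [????]; rewrite /addq /= !addNr. Qed.

HB.instance Definition _ :=
  GRing.isZmodule.Build (quat R) addqA addqC add0q addNq.

Lemma mulqA : associative mulq.
Proof. by move=> [????] [????] [????]; rewrite /mulq /=; congr Quat; ring. Qed.

Lemma mul1q : left_id (Quat 1 0 0 0) mulq.
Proof. by move=> [????]; rewrite /mulq /=; congr Quat; ring. Qed.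

Lemma mulq1 : right_id (Quat 1 0 0 0) mulq.
Proof. by move=> [????]; rewrite /mulq /=; congr Quat; ring. Qed.

Lemma mulqDl : left_distributive mulq addq.
Proof. by move=> [????] [????] [????]; rewrite /mulq /addq /=; congr Quat; ring. Qed.

Lemma mulqDr : right_distributive mulq addq.
Proof. by move=> [????] [????] [????]; rewrite /mulq /addq /=; congr Quat; ring. Qed.

Lemma oneq_neq0 : Quat 1 0 0 0 != 0 :> quat R.
Proof. by apply/eqP => -[/eqP]; rewrite oner_eq0. Qed.

HB.instance Definition _ := GRing.Zmodule_isNzRing.Build (quat R)
  mulqA mul1q mulq1 mulqDl mulqDr oneq_neq0.

Definition conjq x := Quat (q0 x) (- q1 x) (- q2 x) (- q3 x).

Definition normq2 x : R := q0 x ^+ 2 + q1 x ^+ 2 + q2 x ^+ 2 + q3 x ^+ 2.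

Definition invq x :=
  Quat (q0 x / normq2 x) (- q1 x / normq2 x) (- q2 x / normq2 x)
       (- q3 x / normq2 x).

Lemma normq2_eq0 x : (normq2 x == 0) = (x == 0).
Proof.
case: x => a b c d; rewrite /normq2 /=.
apply/eqP/eqP => [h|[-> -> -> ->]]; last by rewrite expr0n /= !addr0.
have [ha hb hc hd] : [/\ a ^+ 2 = 0, b ^+ 2 = 0, c ^+ 2 = 0 & d ^+ 2 = 0].
  have := sqr_ge0 a; have := sqr_ge0 b; have := sqr_ge0 c.
  by have := sqr_ge0 d; split; lra.
by congr Quat; apply/eqP; rewrite -sqrf_eq0; apply/eqP.
Qed.

Lemma mulVq : {in [pred x | x != 0], left_inverse 1 invq *%R}.
Proof.
move=> x; rewrite inE -normq2_eq0; case: x => a b c d; rewrite /normq2 /= => h.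
by rewrite /GRing.mul /= /mulq /invq /normq2 /=; congr Quat; field.
Qed.

Lemma mulqV : {in [pred x | x != 0], right_inverse 1 invq *%R}.
Proof.
move=> x; rewrite inE -normq2_eq0; case: x => a b c d; rewrite /normq2 /= => h.
by rewrite /GRing.mul /= /mulq /invq /normq2 /=; congr Quat; field.
Qed.

Lemma unitqP x y : y * x = 1 /\ x * y = 1 -> x \in [pred z : quat R | z != 0].
Proof.
case=> h _; rewrite inE; apply/eqP => x0.
by move: h; rewrite x0 mulr0 => /eqP; rewrite eq_sym oner_eq0.
Qed.

Lemma invq_out : {in [predC [pred x : quat R | x != 0]], invq =1 id}.
Proof.
move=> x; rewrite !inE negbK => /eqP ->.
by rewrite /invq /= oppr0 !mul0r.
Qed.

HB.instance Definition _ := GRing.NzRing_hasMulInverse.Build (quat R)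
  mulVq mulqV unitqP invq_out.

End QuatRing.

Section QuatMatrix.
Variable R : realFieldType.
Local Notation H := (quat R).

Definition qhermitian n (A : 'M[H]_n) : Prop := (map_mx (@conjq R) A)^T = A.

(* M *m c is the right-linear combination of the columns of M with
   coefficients c. *)
Definition right_free_cols m n (M : 'M[H]_(m, n)) (S : {set 'I_n}) : Prop :=
  forall c : 'cV[H]_n,
    (forall j, j \notin S -> c j 0 = 0) -> M *m c = 0 -> c = 0.

Definition qrank m n (M : 'M[H]_(m, n)) : nat :=
  (\max_(S : {set 'I_n} | `[< right_free_cols M S >]) #|S|)%N.

Definition is_index n (A : 'M[H]_n) (k : nat) : Prop :=
  qrank (A ^+ k.+1) = qrank (A ^+ k) /\
  forall l : nat, qrank (A ^+ l.+1) = qrank (A ^+ l) -> (k <= l)%N.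

Definition is_drazin n (A X : 'M[H]_n) : Prop :=
  exists k : nat,
    [/\ is_index A k, A ^+ k.+1 *m X = A ^+ k, X *m A *m X = X &
        A *m X = X *m A].

Definition is_drazin_solution n m (A : 'M[H]_n) (B : 'M[H]_m)
    (D X : 'M[H]_(n, m)) : Prop :=
  exists AD BD, [/\ is_drazin A AD, is_drazin B BD & X = AD *m D *m BD].

Definition repl_col m n (M : 'M[H]_(m, n)) (i : 'I_n) (b : 'cV[H]_m) :
    'M[H]_(m, n) :=
  \matrix_(p, q) if q == i then b p 0 else M p q.

Definition repl_row m n (M : 'M[H]_(m, n)) (j : 'I_m) (b : 'rV[H]_n) :
    'M[H]_(m, n) :=
  \matrix_(p, q) if p == j then b 0 q else M p q.

Section RowColDet.
Variable n : nat.
Implicit Types (M : 'M[H]_n) (beta : {set 'I_n}) (i : 'I_n) (s : 'S_n).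

(* For i in beta and s a permutation of beta: the leading elements of the
   cycles of s on beta (fixed points in beta included), namely i followed, in
   increasing order, by the smallest elements of the cycles avoiding i. *)
Definition cycle_heads beta i s : seq 'I_n :=
  i :: [seq x <- enum beta |
         (x \notin porbit s i) && [forall y in porbit s x, (x <= y)%N]].

(* m_(x, s x) * m_(s x, s (s x)) * ... ; the indices are those of both the
   cycle product m_C of a row determinant (cycle written from its first
   element x) and m'_C of a column determinant (cycle written up to its last
   element x). *)
Definition cycle_prod M s (x : 'I_n) : H := \prod_(y <- fingraph.orbit s x) M y (s y).

(* rdet beta M i and cdet beta M i are the i-th row and column determinants of
   the principal submatrix of M on beta, whose rows and columns keep their
   labels in 'I_n: the sums are over the permutations of beta.  They are meant
   for i in beta; beta = [set: 'I_n] gives those of M itself. *)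
Definition rdet beta M i : H :=
  \sum_(s : 'S_n | perm_on beta s)
    (-1) ^+ (#|beta| - size (cycle_heads beta i s)) *
    \prod_(x <- cycle_heads beta i s) cycle_prod M s x.

Definition cdet beta M i : H :=
  \sum_(s : 'S_n | perm_on beta s)
    (-1) ^+ (#|beta| - size (cycle_heads beta i s)) *
    \prod_(x <- rev (cycle_heads beta i s)) cycle_prod M s x.

(* Determinant of the principal submatrix on beta of a Hermitian matrix: its
   row and column determinants all have the same (real) value, so any row can
   be picked.  The empty determinant is 1. *)
Definition hdet beta M : H :=
  if [pick i in beta] is Some i then rdet beta M i else 1.

Definition sum_hdet r M : H := \sum_(beta : {set 'I_n} | #|beta| == r) hdet beta M.

Definition sum_cdet r M i (b : 'cV[H]_n) : H :=
  \sum_(beta : {set 'I_n} | (#|beta| == r) && (i \in beta))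
    cdet beta (repl_col M i b) i.

Definition sum_rdet r M i (b : 'rV[H]_n) : H :=
  \sum_(beta : {set 'I_n} | (#|beta| == r) && (i \in beta))
    rdet beta (repl_row M i b) i.

End RowColDet.
End QuatMatrix.

(* Main.v *)
Require Import Defs.
From mathcomp Require Import all_boot all_order all_fingroup all_algebra.
From mathcomp Require Import ring lra zify.
From mathcomp Require Import boolp reals.

(* Let G be Hermitian.  Reversing one cycle of a permutation conjugates the
   product of G along it, so in a row or column determinant all cycle products
   except the one through the distinguished index may be replaced by their real
   parts.  Hence rdet_i G = cdet_i G is a real number d(beta) independent of i
   (on each principal submatrix G_beta), and the cofactor matrix L(beta), with
   entries cdet_i of G_beta with its i-th column replaced by a basis vector, is
   Hermitian.  Deleting an index from its cycle expresses L(beta) through the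
   L(beta \ p); by Hermitian symmetry the same holds from the other end of the
   cycle, and induction gives L(beta) G = d(beta) on beta.

   Summing over #|beta| = k yields C_(k+1) = d_k - C_k G with C_0 = C_(n+1) = 0,
   a Faddeev-LeVerrier recursion, and trace (C_k G) = k d_k.  If r is the last k
   with d_k != 0, then C_(r+1) is annihilated on the right by a power of G,
   hence by G itself as G is Hermitian: C_r G^2 = d_r G.  So C_r G / d_r is a
   projection onto the range of G, and comparing traces r is the rank of G.
   For G = A^(k1+1) and y in the range of G this reads C_r G y = d_r y, which is
   Cramer's rule for the Drazin inverse; rows follow by conjugation. *)

Set Implicit Arguments.
Unset Strict Implicit.
Unset Printing Implicit Defensive.

Import Order.TTheory GRing.Theory Num.Theory.
Local Open Scope ring_scope.

(** * Conjugation, real part and real scalars of the quaternions *)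

Section Quaternions.
Variable R : realFieldType.
Local Notation H := (quat R).
Implicit Types x y : H.

Definition real_quat (a : R) : H := Quat a 0 0 0.

Lemma conjqD x y : conjq (x + y) = conjq x + conjq y.
Proof. by case: x y => [????] [????]; congr Quat => /=; rewrite ?opprD. Qed.

Lemma conjqM x y : conjq (x * y) = conjq y * conjq x.
Proof. by case: x y => [????] [????]; congr Quat => /=; ring. Qed.

Lemma conjqK : involutive (@conjq R).
Proof. by case=> [????]; rewrite /conjq /= !opprK. Qed.

Lemma conjq0 : conjq (0 : H) = 0.
Proof. by congr Quat; rewrite oppr0. Qed.

Lemma conjq1 : conjq (1 : H) = 1.
Proof. by congr Quat; rewrite oppr0. Qed.

Lemma conjqN x : conjq (- x) = - conjq x.
Proof. by case: x. Qed.

Lemma conjq_real a : conjq (real_quat a) = real_quat a.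
Proof. by congr Quat; rewrite oppr0. Qed.

Lemma conjq_sum I (r : seq I) (P : pred I) (F : I -> H) :
  conjq (\sum_(i <- r | P i) F i) = \sum_(i <- r | P i) conjq (F i).
Proof. exact: (big_morph _ conjqD conjq0). Qed.

Lemma conjq_prod I (r : seq I) (F : I -> H) :
  conjq (\prod_(i <- r) F i) = \prod_(i <- rev r) conjq (F i).
Proof.
elim: r => [|i r IH]; first by rewrite !big_nil conjq1.
by rewrite big_cons conjqM IH rev_cons -cats1 big_cat big_seq1.
Qed.

Lemma conjq_sign k x : conjq ((-1) ^+ k * x) = (-1) ^+ k * conjq x.
Proof. by elim: k => [|k IH];
  rewrite ?mul1r // !exprS !mulN1r !mulNr conjqN IH. Qed.

Lemma real_quatD a b : real_quat (a + b) = real_quat a + real_quat b.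
Proof. by congr Quat; rewrite addr0. Qed.

Lemma real_quatM a b : real_quat (a * b) = real_quat a * real_quat b.
Proof. by congr Quat => /=; ring. Qed.

Lemma real_quatN a : real_quat (- a) = - real_quat a.
Proof. by congr Quat; rewrite oppr0. Qed.

Lemma real_quat_eq0 a : (real_quat a == 0) = (a == 0).
Proof. by apply/eqP/eqP => [[]|->]. Qed.

Lemma real_quat_sum I (r : seq I) (P : pred I) (F : I -> R) :
  real_quat (\sum_(i <- r | P i) F i) = \sum_(i <- r | P i) real_quat (F i).
Proof. exact: (big_morph _ real_quatD (erefl _)). Qed.

Lemma real_quat_prod I (r : seq I) (P : pred I) (F : I -> R) :
  real_quat (\prod_(i <- r | P i) F i) = \prod_(i <- r | P i) real_quat (F i).
Proof. exact: (big_morph _ real_quatM (erefl _)). Qed.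

Lemma real_quat_sign k a : real_quat ((-1) ^+ k * a) = (-1) ^+ k * real_quat a.
Proof. by elim: k => [|k IH];
  rewrite ?mul1r // !exprS !mulN1r !mulNr real_quatN IH. Qed.

Lemma real_quatC a x : real_quat a * x = x * real_quat a.
Proof. by case: x => [????]; congr Quat => /=; ring. Qed.

Lemma addq_conj x : x + conjq x = real_quat (q0 x) *+ 2.
Proof. by case: x => [????]; rewrite mulr2n; congr Quat => /=; ring. Qed.

Lemma q0M x y : q0 (x * y) = q0 (y * x).
Proof. by case: x y => [????] [????] /=; ring. Qed.

Lemma q0D x y : q0 (x + y) = q0 x + q0 y.
Proof. by []. Qed.

Lemma q0_sum I (r : seq I) (P : pred I) (F : I -> H) :
  q0 (\sum_(i <- r | P i) F i) = \sum_(i <- r | P i) q0 (F i).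
Proof. exact: (big_morph (@q0 R) q0D (erefl _)). Qed.

Lemma mulq_conj x : x * conjq x = real_quat (normq2 x).
Proof. by case: x => [????]; congr Quat; rewrite /normq2 /=; ring. Qed.

Lemma mulrn2_injq : injective (fun x : H => x *+ 2).
Proof.
move=> [a b c d] [a' b' c' d']; rewrite !mulr2n => -[h0 h1 h2 h3].
by congr Quat; lra.
Qed.

End Quaternions.

(** * Orbits of a permutation listed as cycles *)

Section PermOrbits.
Variable T : finType.
Implicit Types (s t : {perm T}) (x y : T).
Local Notation orb := (fingraph.orbit).

Lemma mem_orbit_perm s x y : (y \in orb s x) = (y \in porbit s x).
Proof.
rewrite -fconnect_orbit; apply/idP/porbitP => [/iter_findex <-|[i ->]].
  by exists (findex s x y); rewrite permX.
by rewrite permX fconnect_iter.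
Qed.

Lemma orbit_perm_cons s x : orb s x = x :: behead (orb s x).
Proof. by rewrite /fingraph.orbit -orderSpred. Qed.

Lemma fcycle_orbit_perm s x (u : seq T) :
  fcycle s (x :: u) -> uniq (x :: u) -> orb s x = x :: u.
Proof. by move=> cu uu;
  rewrite (fingraph.orbitE cu uu) ?mem_head //= eqxx rot0. Qed.

Lemma eq_in_orbit s t x : {in porbit s x, s =1 t} -> orb t x = orb s x.
Proof.
move=> st; have co := cycle_orbit (@perm_inj _ s) x; have uo := orbit_uniq s x.
rewrite orbit_perm_cons in co uo *; apply: fcycle_orbit_perm => //.
rewrite (eq_in_cycle (P := mem (porbit s x)) (e' := frel s)) // => [y z yo zo|].
  by rewrite /= st.
by apply/allP => y; rewrite -orbit_perm_cons mem_orbit_perm.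
Qed.

Lemma eq_in_porbit s t x : {in porbit s x, s =1 t} -> porbit t x = porbit s x.
Proof.
by move=> st; apply/setP => y; rewrite -!mem_orbit_perm (eq_in_orbit st).
Qed.

Lemma orbit_perm_next s x : orb s (s x) = rot 1 (orb s x).
Proof.
have co := cycle_orbit (@perm_inj _ s) x; have uo := orbit_uniq s x.
case E: (orb s x) co uo (orbit_perm_cons s x) => [|y u] // co uo [yx].
rewrite yx {y yx} in co uo E *; rewrite rot1_cons.
case: u co uo E => [|y u] co uo E.
  by move: co => /=; rewrite andbT => /eqP ->.
have /eqP -> : s x == y by case/andP: co.
apply: fcycle_orbit_perm; first by rewrite -rcons_cons -rot1_cons rot_cycle.
by rewrite -rcons_cons -rot1_cons rot_uniq.
Qed.

Lemma last_orbit_perm s x : s (last x (orb s x)) = x.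
Proof.
have := cycle_orbit (@perm_inj _ s) x; rewrite orbit_perm_cons /=.
by rewrite rcons_path => /andP[_ /eqP].
Qed.

Lemma map_orbit_perm s x : map s (orb s x) = rot 1 (orb s x).
Proof.
rewrite -orbit_perm_next; have := size_orbit s (s x).
rewrite {1}orbit_perm_next size_rot size_orbit /fingraph.orbit => <-.
by move: (fingraph.order s x) => k; elim: k x => //= k IH y; rewrite IH.
Qed.

(** The reversed list starts at [s^-1 x]; applying [s] entrywise shifts it so that it starts at [x]
    again. *)
Lemma orbit_permV s x : orb s^-1%g x = map s (rev (orb s x)).
Proof.
rewrite map_rev map_orbit_perm; have := orbit_perm_cons s x.
have := orbit_uniq s x; have := cycle_orbit (@perm_inj _ s) x.
case: (orb s x) => [|y u] // co uo [yx]; rewrite yx in co uo *.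
rewrite rot1_cons rev_rcons; apply: fcycle_orbit_perm; last first.
  by rewrite -rev_rcons rev_uniq -rot1_cons rot_uniq.
rewrite -rev_rcons rev_cycle -rot1_cons rot_cycle.
by rewrite (eq_cycle (e' := frel s)) // => a b /=;
  rewrite (canF_eq (permK s)) eq_sym.
Qed.

End PermOrbits.

(** * Reversing one cycle of a permutation *)

Section ReverseCycle.
Variable T : finType.
Implicit Types (s : {perm T}) (x y : T).
Local Notation orb := (fingraph.orbit).

Lemma porbit_next s x y : (s y \in porbit s x) = (y \in porbit s x).
Proof. by rewrite ![_ \in porbit s x]porbit_sym -(porbit_perm s 1 y) expg1. Qed.

Lemma porbit_prev s x y : (s^-1%g y \in porbit s x) = (y \in porbit s x).
Proof. by rewrite -porbit_next permKV. Qed.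

Lemma flip_cycle_subproof s x :
  injective (fun y => if y \in porbit s x then s^-1%g y else s y).
Proof.
apply: (can_inj (g := fun y => if y \in porbit s x then s y else s^-1%g y)).
move=> y /=; case: (boolP (y \in porbit s x)) => yx.
  by rewrite porbit_prev yx permKV.
by rewrite porbit_next (negPf yx) permK.
Qed.

Definition flip_cycle s x : {perm T} := perm (@flip_cycle_subproof s x).

Lemma flip_cycle_in s x : {in porbit s x, flip_cycle s x =1 s^-1%g}.
Proof. by move=> y yx; rewrite permE yx. Qed.

Lemma flip_cycle_out s x y : y \notin porbit s x -> flip_cycle s x y = s y.
Proof. by move=> yx; rewrite permE (negPf yx). Qed.

Lemma porbit_eq s x y : y \in porbit s x -> porbit s y = porbit s x.
Proof. by rewrite -eq_porbit_mem => /eqP. Qed.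

Lemma porbit_disj s x y z :
  y \notin porbit s x -> z \in porbit s y -> z \notin porbit s x.
Proof.
by move=> yx /porbit_eq zy; rewrite -eq_porbit_mem zy eq_porbit_mem.
Qed.

Lemma orbit_flip_cycle_out s x y :
  y \notin porbit s x -> orb (flip_cycle s x) y = orb s y.
Proof.
move=> yx; apply: eq_in_orbit => z zy; rewrite flip_cycle_out //.
exact: porbit_disj zy.
Qed.

Lemma porbit_flip_cycle s x y : porbit (flip_cycle s x) y = porbit s y.
Proof.
have [yx|yx] := boolP (y \in porbit s x); last first.
  by apply/setP => z; rewrite -!mem_orbit_perm orbit_flip_cycle_out.
rewrite -(porbitV s); apply: eq_in_porbit => z; rewrite porbitV => zy.
by rewrite flip_cycle_in // -(porbit_eq yx).
Qed.

Lemma flip_cycleK s x : flip_cycle (flip_cycle s x) x = s.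
Proof.
apply/permP => y; have [yx|yx] := boolP (y \in porbit s x); last first.
  by rewrite !flip_cycle_out ?porbit_flip_cycle.
rewrite flip_cycle_in ?porbit_flip_cycle //;
  apply: (@perm_inj _ (flip_cycle s x)).
by rewrite permKV flip_cycle_in ?permK // porbit_next.
Qed.

(** Parity depends only on the set of orbits, which reversal preserves. *)
Lemma odd_flip_cycle s x : flip_cycle s x = s :> bool.
Proof.
rewrite /odd_perm; congr (_ (+) odd #|pred_of_set _|).
by apply: eq_imset => y; rewrite porbit_flip_cycle.
Qed.

Lemma perm_on_flip_cycle (S : {set T}) s x :
  perm_on S (flip_cycle s x) = perm_on S s.
Proof.
apply: eq_subset => y; rewrite !inE; congr (~~ _).
have [yx|yx] := boolP (y \in porbit s x); last by rewrite flip_cycle_out.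
by rewrite flip_cycle_in // (canF_eq (permKV s)) eq_sym.
Qed.

End ReverseCycle.

(** * Products of matrix entries along cycles *)

Section CycleProducts.
Variables (R : realFieldType) (n : nat).
Local Notation H := (quat R).
Implicit Types (M G : 'M[H]_n) (s : 'S_n) (x y i : 'I_n) (beta : {set 'I_n}).

(** By conversion [qhermitian G] is [conjmx G = G]; later type casts rely on this. *)
Definition conjmx m p (M : 'M[H]_(m, p)) : 'M[H]_(p, m) :=
  (map_mx (@conjq R) M)^T.

Lemma conj_cycle_prod M s x :
  conjq (cycle_prod M s x) = cycle_prod (conjmx M) s^-1%g x.
Proof.
rewrite /cycle_prod conjq_prod orbit_permV big_map.
by apply: eq_bigr => y _; rewrite permK !mxE.
Qed.

Lemma eq_in_cycle_prod M s s' x :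
  {in porbit s x, s =1 s'} -> cycle_prod M s' x = cycle_prod M s x.
Proof.
move=> ss'; rewrite /cycle_prod (eq_in_orbit ss').
by apply: eq_big_seq => y; rewrite mem_orbit_perm => /ss' ->.
Qed.

Lemma cycle_prod_rev G s x :
  qhermitian G -> cycle_prod G (flip_cycle s x) x = conjq (cycle_prod G s x).
Proof.
move=> hG; rewrite conj_cycle_prod /conjmx hG; apply: eq_in_cycle_prod => y.
by rewrite porbitV => yx; rewrite flip_cycle_in.
Qed.

Lemma cycle_prod_rev_out M s x y :
  y \notin porbit s x -> cycle_prod M (flip_cycle s x) y = cycle_prod M s y.
Proof.
move=> yx; apply: eq_in_cycle_prod => z zy; rewrite flip_cycle_out //.
exact: porbit_disj zy.
Qed.

Definition cycle_re M s x : R := q0 (cycle_prod M s x).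

(** Starting one step later moves the first factor to the end, which the real part does not see. So
    the real part belongs to the cycle, not to its starting element. *)
Lemma cycle_re_next M s x : cycle_re M s (s x) = cycle_re M s x.
Proof.
rewrite /cycle_re /cycle_prod orbit_perm_next orbit_perm_cons rot1_cons.
by rewrite -cats1 big_cat big_seq1 q0M big_cons.
Qed.

Lemma cycle_re_porbit M s x y :
  y \in porbit s x -> cycle_re M s y = cycle_re M s x.
Proof.
move=> /porbitP[k ->]; rewrite permX.
by elim: k => //= k IH; rewrite cycle_re_next.
Qed.

(* Reversing one cycle conjugates the product along it, so averaging over the
   two orientations leaves the real part; the heads are treated one by one. *)
Lemma sum_cycle_prod_re G (P : pred 'S_n) (hs : 'S_n -> seq 'I_n)
    (E F : 'S_n -> H) :
    qhermitian G ->
    (forall s, uniq (hs s)) ->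
    (forall s x y, x \in hs s -> y \in hs s -> x != y -> y \notin porbit s x) ->
    (forall s x, x \in hs s -> [/\ P (flip_cycle s x) = P s,
       hs (flip_cycle s x) = hs s, E (flip_cycle s x) = E s &
       F (flip_cycle s x) = F s]) ->
  \sum_(s | P s) E s * (\prod_(x <- hs s) cycle_prod G s x) * F s =
  \sum_(s | P s) E s * real_quat (\prod_(x <- hs s) cycle_re G s x) * F s.
Proof.
move=> hG uhs dhs inv.
(* [S a] interpolates: heads with label below [a] already carry real parts. [S 0] has the full
   products and [S n] only real parts. *)
pose w a s x :=
  if (x < a)%N then real_quat (cycle_re G s x) else cycle_prod G s x.
pose S a := \sum_(s | P s) E s * (\prod_(x <- hs s) w a s x) * F s.
suff Sa a : S a = S 0%N.
  transitivity (S n); first by rewrite Sa.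
  apply: eq_bigr => s _; rewrite real_quat_prod; congr (_ * _ * _).
  by apply: eq_bigr => x _; rewrite /w ltn_ord.
elim: a => // a <-; have [an|na] := ltnP a n; last first.
  apply: eq_bigr => s _; congr (_ * _ * _); apply: eq_bigr => x _.
  by rewrite /w !(leq_trans (ltn_ord x)) // (leq_trans na).
pose x0 := Ordinal an; pose f s := if x0 \in hs s then flip_cycle s x0 else s.
have fK : involutive f.
  move=> s; rewrite /f; case: (boolP (x0 \in hs s)) => h;
    last by rewrite (negPf h).
  by have [_ -> _ _] := inv _ _ h; rewrite h flip_cycleK.
have w0 s x : x != x0 -> w a.+1 s x = w a s x.
  by move=> xx; rewrite /w ltnS leq_eqVlt -[(x == a :> nat)]/(x == x0)
    (negPf xx).
(* One of two copies of [S a] is reindexed by [f]: this pairs each term with the one where the cycle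
   headed by [x0] is reversed, and the two factors at [x0] add up to twice the real part. *)
apply: mulrn2_injq; rewrite [RHS]mulr2n {2}/S (reindex_inj (can_inj fK)) /=.
rewrite (eq_bigl P) => [|s]; last first.
  by rewrite /f; case: ifP => // /inv[].
rewrite -big_split -sumrMnl /=; apply: eq_bigr => s _; rewrite /f.
case: ifP => x0s; last first.
  rewrite mulr2n; congr (_ * _ * _ + _ * _ * _);
    apply: eq_big_seq => x xs; rewrite w0 //; apply: contraFneq x0s => <- //.
have [_ -> -> ->] := inv _ _ x0s; rewrite -mulrDl -mulrDr.
rewrite -mulrnAl -mulrnAr; congr (_ * _ * _).
have dx0 x : x \in hs s -> x != x0 -> w a (flip_cycle s x0) x = w a s x.
  move=> xs xx; rewrite /w /cycle_re cycle_prod_rev_out //.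
  by apply: dhs => //; rewrite eq_sym.
move: (uhs s) dx0; case/splitPr: x0s => u v; rewrite cat_uniq /= => /and3P[_].
rewrite negb_or => /andP[x0u _] /andP[x0v _] dx0.
have uE x : x \in u ->
  w a (flip_cycle s x0) x = w a s x /\ w a.+1 s x = w a s x.
  move=> xu; have xx : x != x0 by apply: contraNneq x0u => <-.
  by rewrite w0 // dx0 // mem_cat xu.
have vE x : x \in v ->
  w a (flip_cycle s x0) x = w a s x /\ w a.+1 s x = w a s x.
  move=> xv; have xx : x != x0 by apply: contraNneq x0v => <-.
  by rewrite w0 // dx0 // mem_cat inE xv !orbT.
rewrite !big_cat !big_cons /=.
rewrite (eq_big_seq (w a s) (fun x xu => (uE x xu).2)).
rewrite (eq_big_seq (w a s) (fun x xv => (vE x xv).2)).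
rewrite (eq_big_seq (w a s) (fun x xu => (uE x xu).1)).
rewrite (eq_big_seq (w a s) (fun x xv => (vE x xv).1)).
rewrite -mulrDr -mulrDl addrC /w ltnn ltnSn cycle_prod_rev // addq_conj.
by rewrite mulrnAl mulrnAr.
Qed.

End CycleProducts.

(** * Leading elements of cycles, and signs *)

Section CycleHeads.
Variable n : nat.
Implicit Types (s : 'S_n) (x y i : 'I_n) (beta : {set 'I_n}).

Definition orbit_min s x := [forall y in porbit s x, (x <= y)%N].

Definition other_heads beta i s :=
  [seq x <- enum beta | (x \notin porbit s i) && orbit_min s x].

Lemma mem_other_heads beta i s x : (x \in other_heads beta i s) =
  [&& x \notin porbit s i, orbit_min s x & x \in beta].
Proof. by rewrite mem_filter mem_enum -andbA. Qed.

Lemma other_heads_uniq beta i s : uniq (other_heads beta i s).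
Proof. by rewrite filter_uniq ?enum_uniq. Qed.

Lemma orbit_min_ex s x : exists2 y, y \in porbit s x & orbit_min s y.
Proof.
case: (arg_minnP (fun y => nat_of_ord y) (porbit_id s x)) => y yx ymin.
exists y => //; apply/forallP => z; apply/implyP => zy; apply: ymin.
by rewrite -(porbit_eq yx).
Qed.

Lemma orbit_min_uniq s x y :
  orbit_min s x -> orbit_min s y -> y \in porbit s x -> x = y.
Proof.
move=> /forallP/(_ y)/implyP xy /forallP/(_ x)/implyP yx yox.
by apply/val_inj/eqP; rewrite eqn_leq xy // yx // porbit_sym.
Qed.

Lemma eq_orbit_min s s' x : porbit s x = porbit s' x -> orbit_min s x =
  orbit_min s' x.
Proof. by rewrite /orbit_min => ->. Qed.

Lemma porbit_fix s x : s x = x -> porbit s x = [set x].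
Proof.
move=> sx; apply/setP => y; rewrite inE; apply/porbitP/eqP => [[k ->]|->].
  by rewrite permX; elim: k => //= k ->.
by exists 0%N; rewrite perm1.
Qed.

Lemma perm_on_porbit beta s x :
  perm_on beta s -> x \in beta -> porbit s x \subset beta.
Proof.
move=> bs xb; apply/subsetP => y /porbitP[k ->]; rewrite permX.
by elim: k => //= k IH; rewrite perm_closed.
Qed.

Lemma orbit_min_fix s x : s x = x -> orbit_min s x.
Proof.
by move=> sx; apply/forallP => y; rewrite porbit_fix // inE;
  apply/implyP => /eqP ->.
Qed.

(** The two sides differ only in the representative of the cycle of [i], its minimum or [i] itself,
    and [phi] is constant on cycles. This later removes the dependence on [i]. *)
Lemma big_orbit_min (V : Type) (idx : V) (op : Monoid.com_law idx)
    (phi : 'I_n -> V) beta i s :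
    perm_on beta s -> i \in beta ->
    (forall x y, y \in porbit s x -> phi y = phi x) ->
  \big[op/idx]_(x in beta | orbit_min s x) phi x =
  op (phi i) (\big[op/idx]_(x <- other_heads beta i s) phi x).
Proof.
move=> bs ib phiE; have [y yi ymin] := orbit_min_ex s i.
have yb : y \in beta by apply: subsetP yi; apply: perm_on_porbit.
rewrite (bigD1 y) /= ?yb // (phiE i y yi); congr (op _ _).
rewrite big_filter big_enum_cond /=; apply: eq_bigl => x.
rewrite -andbA; congr (_ && _); rewrite andbC.
have [xmin|] := boolP (orbit_min s x); last by rewrite !andbF.
rewrite !andbT; congr (~~ _); apply/eqP/idP => [->//|xi].
apply/esym/(orbit_min_uniq (s := s)) => //.
by rewrite (porbit_eq yi).
Qed.

Lemma card_orbit_min s : #|orbit_min s| = #|porbits s|.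
Proof.
have -> : porbits s = [set porbit s x | x in [set x | orbit_min s x]].
  apply/setP => C; apply/imsetP/imsetP => [[x _ ->]|[x _ ->]]; last by exists x.
  have [y yx ymin] := orbit_min_ex s x; exists y; rewrite ?inE //.
  by apply/eqP; rewrite eq_sym eq_porbit_mem.
rewrite card_in_imset ?cardsE // => x y; rewrite !inE => xmin ymin xy.
by apply: (orbit_min_uniq (s := s)) => //; rewrite xy porbit_id.
Qed.

(** The cycles of [s] on all of ['I_n] are those on [beta] and the fixed points outside [beta]; the
    latter change the degree and the number of cycles equally. *)
Lemma sign_cycle_heads (A : pzRingType) beta i s :
  perm_on beta s -> i \in beta ->
  (-1) ^+ (#|beta| - size (cycle_heads beta i s)) = (-1) ^+ s :> A.
Proof.
move=> bs ib; have ko := @big_orbit_min _ _ addn (fun=> 1%N) _ _ _ bs ib.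
have -> : size (cycle_heads beta i s) = (\sum_(x in beta | orbit_min s x) 1)%N.
  by rewrite ko // sum1_size.
rewrite -signr_odd oddB; last first.
  by rewrite -sum1_card big_mkcondr leq_sum // => x _; case: orbit_min.
have cE : #|orbit_min s| = (\sum_(x in beta | orbit_min s x) 1 + #|~: beta|)%N.
  rewrite -!sum1_card (bigID (mem beta)) /=.
  congr (_ + _)%N; apply: eq_bigl => x; first by rewrite andbC.
  rewrite inE andbC; case: (boolP (x \in beta)) => //= xb.
  exact/orbit_min_fix/(out_perm bs).
congr (_ ^+ nat_of_bool _);
  rewrite /odd_perm -card_orbit_min cE -(cardsC beta) !oddD.
by case: (odd #|beta|); case: (odd #|~: beta|); case: (odd _).
Qed.

End CycleHeads.

(** * Determinants of Hermitian matrices and the cofactor matrix *)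

Section RowColumnDeterminants.
Variables (R : realFieldType) (n : nat).
Local Notation H := (quat R).
Local Notation orb := (fingraph.orbit).
Implicit Types (M G : 'M[H]_n) (s : 'S_n) (x y i p q : 'I_n).
Implicit Types beta : {set 'I_n}.
Implicit Types b : 'cV[H]_n.

Lemma cdetE beta M i : i \in beta ->
  cdet beta M i = \sum_(s : 'S_n | perm_on beta s)
    (-1) ^+ s * (\prod_(x <- rev (other_heads beta i s)) cycle_prod M s x) *
    cycle_prod M s i.
Proof.
move=> ib; apply: eq_bigr => s bs; rewrite sign_cycle_heads // -mulrA.
by rewrite rev_cons -cats1 big_cat big_seq1.
Qed.

Lemma other_heads_flip beta i s x :
  other_heads beta i (flip_cycle s x) = other_heads beta i s.
Proof.
apply: eq_filter => y; rewrite porbit_flip_cycle.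
by rewrite (eq_orbit_min (porbit_flip_cycle s x y)).
Qed.

Lemma other_heads_disj beta i s x y : x \in other_heads beta i s ->
  y \in other_heads beta i s -> x != y -> y \notin porbit s x.
Proof.
rewrite !mem_other_heads => /and3P[_ xm _] /and3P[_ ym _];
  apply: contraNN => yx.
exact/eqP/(orbit_min_uniq xm ym yx).
Qed.

(** The real number d(beta), written without a distinguished index: each cycle is represented by its
    minimum, and real factors need no order. *)
Definition hermdet beta G : R := \sum_(s : 'S_n | perm_on beta s)
  (-1) ^+ s * \prod_(x in beta | orbit_min s x) cycle_re G s x.

Lemma prod_cycle_re beta G i s : perm_on beta s -> i \in beta ->
  \prod_(x <- cycle_heads beta i s) cycle_re G s x =
  \prod_(x in beta | orbit_min s x) cycle_re G s x.
Proof.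
move=> bs ib; rewrite (big_orbit_min _ bs ib) ?big_cons // => x y.
exact: cycle_re_porbit.
Qed.

Lemma cycle_heads_disj beta i s x y : x \in cycle_heads beta i s ->
  y \in cycle_heads beta i s -> x != y -> y \notin porbit s x.
Proof.
have ino z : z \in other_heads beta i s -> z \notin porbit s i.
  by rewrite mem_other_heads => /and3P[].
rewrite !in_cons => /predU1P[->|xo] /predU1P[->|yo] //; first by rewrite eqxx.
- by rewrite ino.
- by rewrite porbit_sym ino.
- exact: other_heads_disj xo yo.
Qed.

Lemma cycle_heads_uniq beta i s : uniq (cycle_heads beta i s).
Proof.
rewrite cons_uniq other_heads_uniq andbT mem_filter.
by rewrite porbit_id.
Qed.

Lemma cycle_heads_flip beta i s x :
  cycle_heads beta i (flip_cycle s x) = cycle_heads beta i s.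
Proof. by congr (_ :: _); apply: other_heads_flip. Qed.

Lemma rdet_herm beta G i : qhermitian G -> i \in beta ->
  rdet beta G i = real_quat (hermdet beta G).
Proof.
move=> hG ib; rewrite real_quat_sum.
transitivity (\sum_(s | perm_on beta s) (-1) ^+ s *
    \prod_(x <- cycle_heads beta i s) cycle_prod G s x * 1).
  by apply: eq_bigr => s bs; rewrite sign_cycle_heads // mulr1.
rewrite sum_cycle_prod_re //.
- by apply: eq_bigr => s bs; rewrite real_quat_sign mulr1 prod_cycle_re.
- exact: cycle_heads_uniq.
- by move=> s x y; apply: cycle_heads_disj.
by move=> s x _; rewrite perm_on_flip_cycle odd_flip_cycle cycle_heads_flip.
Qed.

Lemma cdet_herm beta G i : qhermitian G -> i \in beta ->
  cdet beta G i = real_quat (hermdet beta G).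
Proof.
move=> hG ib; rewrite real_quat_sum.
transitivity (\sum_(s | perm_on beta s) (-1) ^+ s *
    \prod_(x <- rev (cycle_heads beta i s)) cycle_prod G s x * 1).
  by apply: eq_bigr => s bs; rewrite sign_cycle_heads // mulr1.
rewrite sum_cycle_prod_re //.
- apply: eq_bigr => s bs; rewrite real_quat_sign mulr1 -(prod_cycle_re _ bs ib).
  by rewrite (perm_big _ (permEl (perm_rev _))).
- by move=> s; rewrite rev_uniq cycle_heads_uniq.
- by move=> s x y; rewrite !mem_rev; apply: cycle_heads_disj.
by move=> s x _; rewrite perm_on_flip_cycle odd_flip_cycle cycle_heads_flip.
Qed.

Lemma perm_on_set0 s : perm_on set0 s = (s == 1%g).
Proof.
apply/idP/eqP => [s0|->]; last exact: perm_on1.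
by apply/permP => x; rewrite perm1 (out_perm s0) ?inE.
Qed.

Lemma hermdet0 G : hermdet set0 G = 1.
Proof.
rewrite /hermdet (eq_bigl _ _ perm_on_set0) big_pred1_eq odd_perm1 mul1r.
by rewrite big_pred0 // => x; rewrite inE.
Qed.

Lemma hdet_herm beta G :
  qhermitian G -> hdet beta G = real_quat (hermdet beta G).
Proof.
move=> hG; rewrite /hdet; case: pickP => [i ib|b0]; first exact: rdet_herm.
have -> : beta = set0 by apply/setP => x; rewrite inE b0.
by rewrite hermdet0.
Qed.

(** The condition drops exactly the last factor, which closes the cycle. What remains runs along the
    path from [i] to [s^-1 i], and is [1] if [s] fixes [i]. *)
Definition open_cycle_prod M s i : H :=
  \prod_(y <- orb s i | s y != i) M y (s y).

(** Column [i] is met only in the closing step of the cycle through [i], so the entry of [b] stands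
    at the right end. *)
Lemma cycle_prod_repl_col M i b s :
  cycle_prod (repl_col M i b) s i = open_cycle_prod M s i * b (s^-1%g i) 0.
Proof.
rewrite /cycle_prod /open_cycle_prod; have := last_orbit_perm s i.
have := orbit_uniq s i; have := in_orbit s i.
case/lastP: (orb s i) => // u l _;
  rewrite last_rcons rcons_uniq => /andP[lu _] sl.
rewrite -cats1 !big_cat !big_seq1 /= big_mkcond
  [X in _ = _ * X * _]big_mkcond big_seq1.
rewrite sl eqxx /= mulr1 -[in b _]sl permK mxE eqxx; congr (_ * _).
rewrite [RHS]big_mkcond; apply: eq_big_seq => y yu.
have /negPf syi : s y != i.
  by rewrite -sl (inj_eq perm_inj); apply: contraNneq lu => <-.
by rewrite mxE syi.
Qed.

Lemma cycle_prod_repl_col_out M i b s x :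
  x \notin porbit s i -> cycle_prod (repl_col M i b) s x = cycle_prod M s x.
Proof.
move=> xi; rewrite /cycle_prod; apply: eq_big_seq => y.
rewrite mem_orbit_perm mxE => yx.
case: eqP => // sy; case/negP: xi.
by rewrite porbit_sym -sy porbit_next.
Qed.

Lemma prod_repl_col_others M i b s beta :
  \prod_(x <- rev (other_heads beta i s)) cycle_prod (repl_col M i b) s x =
  \prod_(x <- rev (other_heads beta i s)) cycle_prod M s x.
Proof.
apply: eq_big_seq => x; rewrite mem_rev mem_other_heads => /and3P[xi _ _].
exact: cycle_prod_repl_col_out.
Qed.

Definition cofactor_term beta M s i : H :=
  (-1) ^+ s * (\prod_(x <- rev (other_heads beta i s)) cycle_prod M s x) *
  open_cycle_prod M s i.

Lemma cdet_repl_col beta M i b : i \in beta ->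
  cdet beta (repl_col M i b) i =
  \sum_(s : 'S_n | perm_on beta s) cofactor_term beta M s i * b (s^-1%g i) 0.
Proof.
move=> ib; rewrite cdetE //; apply: eq_bigr => s bs.
by rewrite prod_repl_col_others cycle_prod_repl_col mulrA.
Qed.

(** The cofactor matrix L(beta), padded with zeros to size [n] so that different [beta] can be added
    and multiplied; columns outside [beta] vanish by [cofactor_mx_out]. *)
Definition cofactor_mx beta M : 'M[H]_n := \matrix_(i, p)
  if i \in beta then cdet beta (repl_col M i (delta_mx p 0)) i else 0.

Lemma cofactor_mxE beta M i p : i \in beta -> cofactor_mx beta M i p =
  \sum_(s : 'S_n | perm_on beta s && (s p == i)) cofactor_term beta M s i.
Proof.
move=> ib; rewrite mxE ib cdet_repl_col // big_mkcondr.
apply: eq_bigr => s _; rewrite mxE andbT (canF_eq (permKV s)) eq_sym.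
by case: eqP => _; rewrite ?mulr1 ?mulr0.
Qed.

Lemma cofactor_mx_out beta M i p : p \notin beta -> cofactor_mx beta M i p = 0.
Proof.
move=> pb; have [ib|ib] := boolP (i \in beta); last by rewrite mxE (negPf ib).
rewrite cofactor_mxE // big_pred0 // => s; apply/andP => -[bs /eqP sp].
by move: pb; rewrite -(perm_closed p bs) sp ib.
Qed.

Lemma cdet_repl_col_cofactor beta M i b : i \in beta ->
  cdet beta (repl_col M i b) i = (cofactor_mx beta M *m b) i 0.
Proof.
move=> ib; rewrite cdet_repl_col // mxE.
rewrite (partition_big (fun s : 'S_n => s^-1%g i) xpredT) //=.
apply: eq_bigr => p _; rewrite cofactor_mxE // mulr_suml.
apply: eq_big => [s|s /andP[_ /eqP ->] //].
by rewrite (canF_eq (permKV s)) [i == _]eq_sym.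
Qed.

Lemma repl_col_id M i : repl_col M i (col i M) = M.
Proof. by apply/matrixP => p q; rewrite !mxE; case: eqP => // ->. Qed.

End RowColumnDeterminants.

(** * Deleting an index from its cycle; Hermitian symmetry of cofactors *)

Section Cofactors.
Variables (R : realFieldType) (n : nat).
Local Notation H := (quat R).
Local Notation orb := (fingraph.orbit).
Implicit Types (M G : 'M[H]_n) (s : 'S_n) (x y i j p q : 'I_n).
Implicit Types beta : {set 'I_n}.

Lemma eq_in_open_cycle_prod M s s' x :
  {in porbit s x, s =1 s'} -> open_cycle_prod M s' x = open_cycle_prod M s x.
Proof.
move=> ss'; rewrite /open_cycle_prod (eq_in_orbit ss') big_seq_cond
  [RHS]big_seq_cond.
apply: eq_big => y.
  by case: (boolP (y \in _)); rewrite ?mem_orbit_perm // => /ss' ->.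
by rewrite mem_orbit_perm => /andP[/ss' ->].
Qed.

(** Only cycles avoiding [i] are reversed. Since [s p = i] puts [p] in the cycle of [i], such a
    reversal respects this condition and the open product. *)
Lemma cofactor_mx_re beta G i p : qhermitian G -> i \in beta ->
  cofactor_mx beta G i p = \sum_(s : 'S_n | perm_on beta s && (s p == i))
    (-1) ^+ s * real_quat (\prod_(x <- other_heads beta i s) cycle_re G s x) *
    open_cycle_prod G s i.
Proof.
move=> hG ib; rewrite cofactor_mxE // /cofactor_term sum_cycle_prod_re //.
- apply: eq_bigr => s _; congr (_ * real_quat _ * _).
  by rewrite (perm_big _ (permEl (perm_rev _))).
- by move=> s; rewrite rev_uniq other_heads_uniq.
- by move=> s x y; rewrite !mem_rev; apply: other_heads_disj.
move=> s x; rewrite mem_rev mem_other_heads porbit_sym => /and3P[xi _ _].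
rewrite perm_on_flip_cycle odd_flip_cycle other_heads_flip; split=> //.
  congr (_ && _); have [px|px] := boolP (p \in porbit s x); last first.
    by rewrite flip_cycle_out.
  rewrite flip_cycle_in //; transitivity false; last apply/esym.
    by apply: contraNF xi => /eqP <-; rewrite porbit_prev.
  by apply: contraNF xi => /eqP <-; rewrite porbit_next.
apply: eq_in_open_cycle_prod => y yi; rewrite flip_cycle_out //.
exact: porbit_disj yi.
Qed.

Lemma other_heads_eq beta beta' i i' s s' :
    (forall x, (x \in beta) && (x \notin porbit s i) =
               (x \in beta') && (x \notin porbit s' i')) ->
    (forall x, x \in beta -> x \notin porbit s i -> porbit s x = porbit s' x) ->
  other_heads beta i s = other_heads beta' i' s'.
Proof.
move=> bb' ss'; rewrite /other_heads /enum_mem -!filter_predI.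
apply: eq_filter => x /=; rewrite andbAC [RHS]andbAC andbC [RHS]andbC.
rewrite [X in _ && X = _]andbC [X in _ = _ && X]andbC.
have := bb' x; case: (boolP (_ && _)) => [/andP[xb xi] <-|_ <-];
  last by rewrite !andbF.
by rewrite !andbT; apply: eq_orbit_min; apply: ss'.
Qed.

(** If [s i = i], the open product is empty and the rest of [s] is an arbitrary permutation of
    [beta :\ i]. *)
Lemma cofactor_mx_diag beta G i : qhermitian G -> i \in beta ->
  cofactor_mx beta G i i = real_quat (hermdet (beta :\ i) G).
Proof.
move=> hG ib; rewrite cofactor_mx_re // real_quat_sum; apply: eq_big => [s|s].
  apply/andP/idP => [[bs /eqP si]|bs].
    apply/subsetP => x xs; rewrite !inE (subsetP bs) // andbT.
    by apply: contraTneq xs => ->; rewrite inE si eqxx.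
  rewrite (out_perm bs) ?eqxx; last by rewrite !inE eqxx.
  by split=> //; apply: subset_trans bs (subD1set _ _).
move=> /andP[bs /eqP si]; have oi := porbit_fix si.
have -> : open_cycle_prod G s i = 1.
  rewrite /open_cycle_prod big_seq_cond big_pred0 // => y.
  by rewrite mem_orbit_perm oi inE; case: eqP => //= ->; rewrite si eqxx.
rewrite mulr1 real_quat_sign big_filter big_enum_cond; congr (_ * real_quat _).
by apply: eq_bigl => x; rewrite oi !inE andbCA andbA.
Qed.

(** The transposition inserts the fixed point [p] between [s^-1 i] and [i]. *)
Lemma orbit_mul_tperm s i p : s p = p -> p != i ->
  orb (s * tperm p i)%g i = rcons (orb s i) p.
Proof.
move=> sp pi; have pu : p \notin orb s i.
  rewrite mem_orbit_perm porbit_sym porbit_fix // inE.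
  by rewrite eq_sym.
have := orbit_uniq s i; have := cycle_orbit (@perm_inj _ s) i.
rewrite orbit_perm_cons in pu *; set u := behead _ in pu *.
rewrite rcons_cons /= rcons_path => /andP[pth /eqP lst] /andP[iu uu].
rewrite inE negb_or in pu; have /andP[_ pu'] := pu.
apply: fcycle_orbit_perm; last first.
  by rewrite /= mem_rcons inE negb_or eq_sym pi iu rcons_uniq pu'.
rewrite /= !rcons_path last_rcons /= !permM lst sp tpermL tpermR !eqxx !andbT.
have tpath v a : i \notin v -> p \notin v -> fpath s a v ->
  fpath (s * tperm p i)%g a v.
  elim: v a => //= z v IH a; rewrite !inE !negb_or.
  move=> /andP[iz iv] /andP[pz pv] /andP[/eqP az pv'].
  by rewrite permM az tpermD // eqxx IH.
exact: tpath.
Qed.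

Section RemoveIndex.
Variables (beta : {set 'I_n}) (s : 'S_n) (i p : 'I_n).
Hypotheses (sp : s p = p) (pi : p != i) (ib : i \in beta) (pb : p \in beta).
Let t := (s * tperm p i)%g.

Lemma mem_porbit_mul_tperm x :
  (x \in porbit t i) = (x == p) || (x \in porbit s i).
Proof. by rewrite -!mem_orbit_perm orbit_mul_tperm // mem_rcons. Qed.

Lemma eq_mul_tperm x : x \notin porbit t i -> {in porbit s x, s =1 t}.
Proof.
rewrite mem_porbit_mul_tperm negb_or => /andP[xp xi] y yx;
  rewrite permM tpermD //.
  apply: contraNneq xp => py;
    rewrite -porbit_next -py porbit_sym porbit_fix // in yx.
  by rewrite inE in yx.
by apply: contraNneq xi => iy; rewrite porbit_sym iy porbit_next.
Qed.

Lemma other_heads_mul_tperm :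
  other_heads beta i t = other_heads (beta :\ p) i s.
Proof.
apply: other_heads_eq => [x|x _ xi]; last by apply: eq_in_porbit;
  apply: eq_mul_tperm.
by rewrite mem_porbit_mul_tperm !inE negb_or; case: (x == p); rewrite ?andbF.
Qed.

Lemma open_cycle_prod_mul_tperm M :
  open_cycle_prod M t i = open_cycle_prod M s i * M (s^-1%g i) p.
Proof.
have tE y : t y = tperm p i (s y) by rewrite permM.
rewrite /open_cycle_prod orbit_mul_tperm // -cats1 big_cat /=.
rewrite [X in _ * X]big_mkcond big_seq1 tE sp tpermL eqxx mulr1.
have ilast := last_orbit_perm s i; have := orbit_uniq s i; have := in_orbit s i.
have pu : p \notin orb s i.
  by rewrite mem_orbit_perm porbit_sym porbit_fix // inE eq_sym.
move: ilast pu; case/lastP: (orb s i) => // u l.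
rewrite last_rcons rcons_uniq => sl pu _ /andP[lu uu].
rewrite -cats1 !big_cat /= ![X in _ * X = _]big_mkcond.
rewrite [X in _ = _ * X * _]big_mkcond !big_seq1.
have -> : s^-1%g i = l by rewrite -sl permK.
rewrite tE sl tpermR eqxx pi mulr1; congr (_ * _).
rewrite big_seq_cond [RHS]big_seq_cond.
have uE y : y \in u -> s y != i /\ t y = s y.
  move=> yu; have si : s y != i.
    by rewrite -sl (inj_eq perm_inj); apply: contraNneq lu => <-.
  split=> //; rewrite tE tpermD //; last by rewrite eq_sym.
  apply: contraNneq pu => py; suff <- : y = p by rewrite mem_rcons inE yu orbT.
  by apply: (@perm_inj _ s); rewrite sp.
apply: eq_big => y; last by move=> /andP[/uE[_ ->]].
by case: (boolP (y \in u)) => //= /uE[_ ->].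
Qed.

Lemma cofactor_term_mul_tperm M :
  cofactor_term beta M t i =
    - (cofactor_term (beta :\ p) M s i * M (s^-1%g i) p).
Proof.
rewrite /cofactor_term other_heads_mul_tperm open_cycle_prod_mul_tperm.
have -> : (-1) ^+ t = - (-1) ^+ s :> H.
  by rewrite odd_permM odd_tperm pi addbT signrN.
rewrite 2!mulNr mulrA; congr (- (_ * _)); congr (_ * _); congr (_ * _).
apply: eq_big_seq => x; rewrite mem_rev -other_heads_mul_tperm mem_other_heads.
by move=> /and3P[xi _ _]; apply: eq_in_cycle_prod; apply: eq_mul_tperm.
Qed.

End RemoveIndex.

(** The entry sums over the permutations in which [p] comes just before [i]. Deleting [p] is a
    bijection onto the permutations of [beta :\ p]; it flips the sign and splits off a last factor
    from column [p] of [M]. *)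
Lemma cofactor_mx_last beta M i p : i \in beta -> p \in beta -> p != i ->
  cofactor_mx beta M i p = - (cofactor_mx (beta :\ p) M *m M) i p.
Proof.
move=> ib pb pi; have ib' : i \in beta :\ p by rewrite !inE eq_sym pi.
transitivity (- cdet (beta :\ p) (repl_col M i (col p M)) i); last first.
  rewrite cdet_repl_col_cofactor // !mxE; congr (- _).
  by apply: eq_bigr => q _; rewrite !mxE.
rewrite cofactor_mxE // cdet_repl_col // -sumrN.
rewrite (reindex_inj (mulIg (tperm p i))) /=.
have sp s : perm_on (beta :\ p) s -> s p = p.
  by move=> bs; rewrite (out_perm bs) // !inE eqxx.
apply: eq_big => [s|s].
  apply/andP/idP => [[bs /eqP]|bs]; last first.
    rewrite permM sp // tpermL eqxx; split=> //; apply: perm_onM.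
      exact: subset_trans bs (subD1set _ _).
    by apply: subset_trans (tperm_on _ _) _; apply/subsetP => x;
      rewrite !inE => /orP[]/eqP->.
  rewrite permM -[RHS](tpermL p i) => /perm_inj sp'.
  apply/subsetP => x xs; rewrite !inE; have [xp|xp] /= := eqVneq x p.
    by rewrite inE xp sp' eqxx in xs.
  apply: contraTT xs => xb; have xi : i != x by apply: contraNneq xb => <-.
  rewrite inE negbK; have := out_perm bs xb; rewrite permM.
  have tx : tperm p i x = x by rewrite tpermD // eq_sym.
  by rewrite -[RHS]tx => /perm_inj ->.
move=> /andP[bs /eqP]; rewrite permM -[RHS](tpermL p i) => /perm_inj sp'.
by rewrite cofactor_term_mul_tperm // mxE.
Qed.

Lemma open_cycle_prod_conj G s i p : qhermitian G -> s p = i ->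
  conjq (open_cycle_prod G s i) = open_cycle_prod G s^-1%g p.
Proof.
move=> hG sp; rewrite /open_cycle_prod -big_filter conjq_prod
  -filter_rev big_filter.
have -> : p = s^-1%g i by rewrite -sp permK.
rewrite orbit_perm_next.
transitivity (\prod_(y <- orb s^-1%g i | y != i) G y (s^-1%g y)).
  rewrite orbit_permV big_map; apply: eq_bigr => y _.
  by rewrite permK -[in LHS]hG !mxE conjqK.
rewrite orbit_perm_cons rot1_cons -cats1 big_cat big_cons eqxx /=.
rewrite [X in _ = _ * X]big_mkcond big_seq1 (inj_eq perm_inj) eqxx mulr1.
by apply: eq_bigl => y; rewrite (inj_eq perm_inj).
Qed.

Lemma cycle_reV G s x : qhermitian G -> cycle_re G s^-1%g x = cycle_re G s x.
Proof.
by move=> hG; rewrite /cycle_re -[in LHS](hG : conjmx G = G) -conj_cycle_prod.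
Qed.

(** Passing to [s^-1] turns the open path from [i] to [p] into the one from [p] to [i], while the
    other cycles contribute real factors by [cofactor_mx_re]. *)
Lemma cofactor_mx_herm beta G : qhermitian G -> conjmx (cofactor_mx beta G) =
  cofactor_mx beta G.
Proof.
move=> hG; apply/matrixP => p i; rewrite 2!mxE.
have [pb|pb] := boolP (p \in beta); last first.
  by rewrite cofactor_mx_out // conjq0 mxE (negPf pb).
have [ib|ib] := boolP (i \in beta); last first.
  by rewrite mxE (negPf ib) conjq0 cofactor_mx_out.
rewrite !cofactor_mx_re // conjq_sum (reindex_inj invg_inj) /=.
apply: eq_big => [s|s /andP[bs /eqP sp]].
  congr (_ && _); last by rewrite (canF_eq (permKV s)) eq_sym.
  by apply/eq_subset => x; rewrite !inE (canF_eq (permKV s)) eq_sym.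
have spi : s i = p by rewrite -sp permKV.
rewrite odd_permV -mulrA conjq_sign conjqM conjq_real
  (open_cycle_prod_conj (p := p)) //.
rewrite invgK -real_quatC mulrA; congr (_ * real_quat _ * _).
have -> : other_heads beta i s^-1%g = other_heads beta p s.
  apply: other_heads_eq => [x|x _ _]; last by rewrite porbitV.
  by rewrite porbitV (porbit_eq (y := p) (x := i)) //
    -spi porbit_next porbit_id.
by apply: eq_bigr => x _; rewrite cycle_reV.
Qed.

End Cofactors.

(** * Conjugate transposes, cancellation and traces *)

Section ConjugateTranspose.
Variable R : realFieldType.
Local Notation H := (quat R).

Lemma conjmx_mul m n p (A : 'M[H]_(m, n)) (B : 'M[H]_(n, p)) :
  conjmx (A *m B) = conjmx B *m conjmx A.
Proof.
apply/matrixP => i j; rewrite !mxE conjq_sum; apply: eq_bigr => k _.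
by rewrite conjqM !mxE.
Qed.

Lemma conjmxK m n (A : 'M[H]_(m, n)) : conjmx (conjmx A) = A.
Proof. by apply/matrixP => i j; rewrite !mxE conjqK. Qed.

(** The diagonal entries of the product are sums of squared norms of the rows' entries. *)
Lemma mulmx_conj_eq0 m n (A : 'M[H]_(m, n)) : A *m conjmx A = 0 -> A = 0.
Proof.
move=> /matrixP A0; apply/matrixP => i j; have := A0 i i; rewrite !mxE => /eqP.
under eq_bigr do rewrite !mxE mulq_conj.
rewrite -real_quat_sum real_quat_eq0 psumr_eq0 => [/allP/(_ j)|k _]; last first.
  by rewrite /normq2 !addr_ge0 ?sqr_ge0.
by rewrite mem_index_enum normq2_eq0 => /(_ isT)/eqP.
Qed.

Lemma mulmx_herm2_eq0 m n (A : 'M[H]_(m, n)) (G : 'M[H]_n) :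
  qhermitian G -> A *m G *m G = 0 -> A *m G = 0.
Proof.
move=> hG AGG; apply: mulmx_conj_eq0.
by rewrite conjmx_mul (hG : conjmx G = G) mulmxA AGG mul0mx.
Qed.

Lemma mulmx_real_scalar m n (A : 'M[H]_(m, n)) a :
  A *m (real_quat a)%:M = (real_quat a)%:M *m A.
Proof.
rewrite mul_scalar_mx -diag_const_mx mul_mx_diag.
by apply/matrixP => i j; rewrite !mxE real_quatC.
Qed.

Lemma q0_trace_mul n (A B : 'M[H]_n) : q0 (\tr (A *m B)) = q0 (\tr (B *m A)).
Proof.
rewrite /mxtrace !q0_sum.
under eq_bigr do rewrite mxE q0_sum.
rewrite exchange_big; apply: eq_bigr => i _; rewrite mxE q0_sum.
by apply: eq_bigr => j _; rewrite q0M.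
Qed.

End ConjugateTranspose.

(** * The adjugate identity and the Faddeev-LeVerrier recursion *)

Section CofactorSums.
Variables (R : realFieldType) (n : nat).
Local Notation H := (quat R).
Variable G : 'M[H]_n.
Hypothesis hG : qhermitian G.
Implicit Types (i j p q : 'I_n) (beta : {set 'I_n}).

Lemma cofactor_mx_first beta i p : i \in beta -> p \in beta -> p != i ->
  cofactor_mx beta G i p = - (G *m cofactor_mx (beta :\ i) G) i p.
Proof.
move=> ib pb pi.
rewrite -cofactor_mx_herm // 2!mxE cofactor_mx_last 1?eq_sym //.
have <- : conjmx (cofactor_mx (beta :\ i) G *m G) =
  G *m cofactor_mx (beta :\ i) G.
  by rewrite conjmx_mul cofactor_mx_herm // (hG : conjmx G = G).
by rewrite conjqN [in RHS]mxE [in RHS]mxE.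
Qed.

(** On the diagonal, column [i] is replaced by itself. Off it, deleting the first index [i] of the
    path reduces the entry to [beta :\ i], where induction on the size makes the terms cancel. *)
Lemma cofactor_mulmx beta i j : i \in beta -> j \in beta ->
  (cofactor_mx beta G *m G) i j = real_quat (hermdet beta G) *+ (i == j).
Proof.
move: {2}#|beta| (erefl #|beta|) => k;
  elim: k beta i => [|k IH] beta i cb ib jb.
  by move: ib; rewrite (cards0_eq cb) inE.
have [<-|ij] := eqVneq i j.
  have -> : (cofactor_mx beta G *m G) i i = (cofactor_mx beta G *m col i G) i 0.
    by rewrite !mxE; apply: eq_bigr => q _; rewrite !mxE.
  by rewrite -cdet_repl_col_cofactor // repl_col_id cdet_herm // mulr1n.
rewrite mxE (bigD1 i) //= cofactor_mx_diag //.
under eq_bigr => q qi.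
  have -> : cofactor_mx beta G i q = - (G *m cofactor_mx (beta :\ i) G) i q.
    have [qb|qb] := boolP (q \in beta); first exact: cofactor_mx_first.
    rewrite cofactor_mx_out // mxE big1 ?oppr0 // => a _.
    by rewrite cofactor_mx_out ?mulr0 // !inE (negPf qb) andbF.
  over.
have jbi : j \in beta :\ i by rewrite !inE eq_sym ij.
(* The term [q = i] may be added: column [i] of [cofactor_mx (beta :\ i) G] is zero. *)
have -> : \sum_(q | q != i) - (G *m cofactor_mx (beta :\ i) G) i q * G q j
    = - (G *m (cofactor_mx (beta :\ i) G *m G)) i j.
  have G0 : (G *m cofactor_mx (beta :\ i) G) i i = 0.
    by rewrite mxE big1 // => a _; rewrite cofactor_mx_out ?mulr0 // !inE eqxx.
  rewrite mulmxA [X in _ = - X]mxE [in RHS](bigD1 i) //= G0 mul0r add0r -sumrN.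
  by apply: eq_bigr => q _; rewrite mulNr.
(* By induction only row [j] survives; it gives [G i j] times d(beta minus i), which cancels the
   diagonal cofactor term. *)
rewrite mxE (bigD1 j) //= big1 => [|a aj].
  rewrite IH // ?eqxx ?mulr1n ?addr0; first by rewrite real_quatC subrr.
  by apply/eqP; rewrite -eqSS -cb (cardsD1 i beta) ib.
have [ab|ab] := boolP (a \in beta :\ i); last first.
  by rewrite mxE big1 ?mulr0 // => q _; rewrite mxE (negPf ab) mul0r.
rewrite IH ?(negPf aj) ?mulr0 //.
by apply/eqP; rewrite -eqSS -cb (cardsD1 i beta) ib.
Qed.

(** For [j] outside [beta] this reads [cofactor_mx_last] and [cofactor_mx_diag] backwards: the
    defect of the adjugate identity is a cofactor of the enlarged set. *)
Lemma cofactor_mx_setU1 beta i j :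
  ((real_quat (hermdet beta G))%:M - cofactor_mx beta G *m G) i j =
  if j \in beta then 0 else cofactor_mx (j |: beta) G i j.
Proof.
have row0 : i \notin beta -> (cofactor_mx beta G *m G) i j = 0.
  by move=> ib; rewrite mxE big1 // => q _; rewrite mxE (negPf ib) mul0r.
rewrite 2!mxE [(- (_ *m _)) i j]mxE.
case: ifPn => jb; have [ib|ib] := boolP (i \in beta).
- by rewrite cofactor_mulmx // subrr.
- by rewrite row0 // subr0; case: eqP => // ij; rewrite ij jb in ib.
- have ij : i != j by apply: contraNneq jb => <-.
  rewrite (negPf ij) add0r cofactor_mx_last ?setU1K // 1?eq_sym //
    !inE ?eqxx //.
  by rewrite ib orbT.
rewrite row0 // subr0; have [->|ij] := eqVneq i j.
  by rewrite cofactor_mx_diag ?setU11 // setU1K.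
by rewrite mxE !inE (negPf ij) (negPf ib).
Qed.

Definition cofactor_sum k : 'M[H]_n :=
  \sum_(beta : {set 'I_n} | #|beta| == k) cofactor_mx beta G.

Definition hermdet_sum k : R :=
  \sum_(beta : {set 'I_n} | #|beta| == k) hermdet beta G.

(** In column [j] only sets containing [j] contribute on the left, and each is [j |: beta] for
    exactly one [beta] of size [k] avoiding [j]. *)
Lemma cofactor_sumS k :
  cofactor_sum k.+1 = (real_quat (hermdet_sum k))%:M - cofactor_sum k *m G.
Proof.
apply/matrixP => i j.
have -> : (real_quat (hermdet_sum k))%:M - cofactor_sum k *m G =
    \sum_(beta : {set 'I_n} | #|beta| == k)
      ((real_quat (hermdet beta G))%:M - cofactor_mx beta G *m G).
  by rewrite sumrB mulmx_suml real_quat_sum raddf_sum.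
rewrite !summxE; under [RHS]eq_bigr do rewrite cofactor_mx_setU1.
rewrite [RHS](bigID (fun beta : {set 'I_n} => j \in beta)) /=
  [X in _ = X + _]big1 ?add0r; last first.
  by move=> beta /andP[_ ->].
rewrite [LHS](bigID (fun beta : {set 'I_n} => j \in beta)) /= [X in _ + X =
  _]big1 ?addr0; last first.
  by move=> beta /andP[_ jb]; rewrite cofactor_mx_out.
rewrite (reindex_onto (fun beta => j |: beta) (fun beta => beta :\ j)) /=;
  last first.
  by move=> beta /andP[_ jb]; rewrite setD1K.
apply: eq_big => [beta|beta /andP[_ /eqP <-]]; last by rewrite !inE eqxx.
rewrite setU11 andbT; have [jb|jb] := boolP (j \in beta).
  rewrite andbF; apply: contraTF jb => /andP[_ /eqP <-]; by rewrite !inE eqxx.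
by rewrite setU1K // eqxx !andbT cardsU1 jb add1n eqSS.
Qed.

Lemma cofactor_sum0 : cofactor_sum 0 = 0.
Proof.
apply: big1 => beta /eqP/cards0_eq ->.
by apply/matrixP => i j; rewrite !mxE inE.
Qed.

Lemma cofactor_sum_gt k : (n < k)%N -> cofactor_sum k = 0.
Proof.
move=> nk; apply: big_pred0 => beta; apply: contraTF nk => /eqP <-.
by rewrite -leqNgt -[leqRHS]card_ord max_card.
Qed.

Lemma hermdet_sum0 : hermdet_sum 0 = 1.
Proof.
by rewrite /hermdet_sum (eq_bigl _ _ (@cards_eq0 _)) big_pred1_eq hermdet0.
Qed.

Lemma cofactor_sum_comm k : G *m cofactor_sum k = cofactor_sum k *m G.
Proof.
elim: k => [|k IH]; first by rewrite cofactor_sum0 mul0mx mulmx0.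
by rewrite cofactor_sumS mulmxBr mulmxBl mulmx_real_scalar mulmxA IH.
Qed.

Lemma trace_cofactor_sum k :
  q0 (\tr (cofactor_sum k *m G)) = hermdet_sum k *+ k.
Proof.
rewrite mulmx_suml raddf_sum q0_sum -sumrMnl; apply: eq_bigr => beta /eqP <-.
rewrite /mxtrace q0_sum (bigID (mem beta)) /= [X in _ + X]big1 ?addr0.
  rewrite (eq_bigr (fun=> hermdet beta G)) ?sumr_const // => i ib.
  by rewrite cofactor_mulmx // eqxx.
by move=> i ib; rewrite mxE big1 // => q _; rewrite mxE (negPf ib) mul0r.
Qed.

(* The recursion of [cofactor_sumS] beyond the last nonzero [hermdet_sum] is
   multiplication by [- G]; it ends in [0], and powers of the Hermitian matrix
   [G] can be cancelled down to the first one. *)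
Lemma cofactor_sum_last : exists k, [/\ hermdet_sum k != 0 &
  cofactor_sum k *m G *m G = (real_quat (hermdet_sum k))%:M *m G].
Proof.
have ex0 : exists k, (k <= n)%N && (hermdet_sum k != 0).
  by exists 0%N; rewrite hermdet_sum0 oner_eq0.
have ub k : (k <= n)%N && (hermdet_sum k != 0) -> (k <= n)%N by case/andP.
case: (ex_maxnP ex0 ub) => k /andP[kn dk] kmax.
exists k; split=> //.
have d0 l : (k < l <= n)%N -> hermdet_sum l = 0.
  move=> /andP[kl ln]; apply/eqP; apply: contraTT kl => dl.
  by rewrite -leqNgt kmax // ln.
(* Descent from index [n.+1], at [l = 0], to [k.+1], at [l = n - k]. *)
suff C0 l : (l <= n - k)%N -> cofactor_sum (n.+1 - l)%N *m G = 0.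
  have := C0 _ (leqnn _); rewrite (subSn (leq_subr _ _)) subKn //.
  by rewrite cofactor_sumS mulmxBl => /eqP; rewrite subr_eq0 => /eqP <-.
elim: l => [_|l IH lnk]; first by rewrite subn0 cofactor_sum_gt ?mul0mx.
have ln : (l < n.+1)%N by rewrite (leq_trans lnk) // (leq_trans (leq_subr _ _)).
apply: mulmx_herm2_eq0 => //; have := IH (ltnW lnk).
rewrite -(subnSK ln) cofactor_sumS d0; last by lia.
rewrite (_ : real_quat 0 = 0) // raddf0 add0r mulNmx => /eqP.
by rewrite oppr_eq0 => /eqP.
Qed.

End CofactorSums.

(** * Column bases and the rank of a Hermitian matrix *)

Section RankAndRange.
Variables (R : realFieldType) (n : nat).
Local Notation H := (quat R).
Implicit Types (A M G X : 'M[H]_n) (i j : 'I_n) (beta S : {set 'I_n}).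

Lemma unit_quat (x : H) : x != 0 -> x \is a GRing.unit.
Proof. by []. Qed.

(** A free set [S] of maximal size spans all columns; [K] collects the right coefficients, giving a
    rank factorization without changing the matrix size. *)
Lemma qrank_basis m (M : 'M[H]_(m, n)) : exists (S : {set 'I_n}) (K : 'M[H]_n),
  [/\ #|S| = qrank M, right_free_cols M S, M = M *m K &
      forall i j, i \notin S -> K i j = 0].
Proof.
have P0 : `[< right_free_cols M set0 >].
  apply/asboolP => c c0 _; apply/matrixP => i j.
  by rewrite (ord1 j) c0 ?inE // mxE.
have [|S /asboolP freeS rS] :=
  @eq_bigmax_cond _ (fun S => `[< right_free_cols M S >]) (fun S => #|S|).
  by apply/card_gt0P; exists set0.
have colP j : exists c : 'cV[H]_n,
    (forall i, i \notin S -> c i 0 = 0) /\ M *m c = col j M.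
  have Me : M *m delta_mx j 0 = col j M by rewrite colE.
  have [jS|jS] := boolP (j \in S).
    exists (delta_mx j 0); split=> // i iS; rewrite mxE andbT.
    by case: eqP iS => // ->; rewrite jS.
  have [free'|] := pselect (right_free_cols M (j |: S)).
    have := @leq_bigmax_cond _ (fun S => `[< right_free_cols M S >])
      (fun S => #|S|) (j |: S).
    by rewrite rS asboolT // => /(_ isT); rewrite cardsU1 jS ltnn.
  move=> nfree; have [c [cS [Mc /eqP c0]]] : exists c : 'cV[H]_n,
      (forall i, i \notin j |: S -> c i 0 = 0) /\ M *m c = 0 /\ c <> 0.
    apply: contrapT => no; apply: nfree => c cS Mc.
    by apply: contrapT => c0; apply: no; exists c.
  have cj : c j 0 != 0.
    apply: contraNneq c0 => cj0; apply/eqP/freeS => // i iS.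
    have [->//|ij] := eqVneq i j; apply: cS.
    by rewrite !inE negb_or ij.
  (* The dependency [c] is normalized on the right, the side of the coefficients, to have [j]th
     entry [1]. *)
  exists (delta_mx j 0 - c *m ((c j 0)^-1)%:M); split.
    move=> i iS; rewrite !mxE big_ord1 !mxE eqxx mulr1n andbT.
    have [->|ij] := eqVneq i j; first by rewrite divrr ?unit_quat ?subrr.
    by rewrite (cS i) ?mul0r ?subr0 // !inE negb_or ij.
  by rewrite mulmxBr mulmxA Mc mul0mx subr0.
have [f fP] := choice colP; exists S, (\matrix_(i, j) f j i 0); split=> //.
  apply/matrixP => i j; have /matrixP/(_ i 0) := (fP j).2.
  by rewrite !mxE => <-; apply: eq_bigr => k _; rewrite !mxE.
by move=> i j iS; rewrite mxE (fP j).1.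
Qed.

(* [C G / d] is a projection onto the range of [G].  The real part of the trace
   satisfies [tr (A B) = tr (B A)] over quaternions too, so for a projection it
   is the rank; here it is also [k], by [trace_cofactor_sum]. *)
Lemma qrank_herm G : qhermitian G ->
  hermdet_sum G (qrank G) != 0 /\
  cofactor_sum G (qrank G) *m G *m G =
    (real_quat (hermdet_sum G (qrank G)))%:M *m G.
Proof.
move=> hG; have [k [dk CGG]] := cofactor_sum_last hG.
suff -> : qrank G = k by [].
have [S [K [cardS freeS GK K0]]] := qrank_basis G.
set C := cofactor_sum G k in CGG *; set d := hermdet_sum G k in dk CGG *.
have comm : G *m C = C *m G by apply: cofactor_sum_comm.
(* [L] is supported on the rows in [S] and satisfies [G L = d G]. Freeness makes its columns in [S]
   equal to [d] times unit vectors, so the real part of its trace, which is that of [C G], is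
   [d *+ #|S|]. *)
have [L LE] : exists L, L = K *m C *m G by exists (K *m C *m G).
have L0 i j : i \notin S -> L i j = 0.
  by move=> iS; rewrite LE -mulmxA mxE big1 // => q _; rewrite K0 ?mul0r.
have GL : G *m L = G *m (real_quat d)%:M.
  by rewrite LE !mulmxA -GK comm CGG mulmx_real_scalar.
have LS i j : j \in S -> L i j = real_quat d *+ (i == j).
  move=> jS; have : col j (L - (real_quat d)%:M) = 0.
    apply: freeS => [q qS|];
      last by rewrite colE mulmxA mulmxBr GL subrr mul0mx.
    rewrite !mxE L0 //; have [qj|] := eqVneq q j; first by rewrite qj jS in qS.
    by rewrite oppr0 addr0.
  by move/matrixP/(_ i 0)/eqP; rewrite !mxE subr_eq0 => /eqP.
have tr : q0 (\tr (C *m G)) = d *+ #|S|.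
  rewrite {1}GK mulmxA q0_trace_mul mulmxA
    -LE /mxtrace q0_sum (bigID (mem S)) /=.
  rewrite [X in _ + X]big1 ?addr0 => [|i iS]; last by rewrite L0.
  rewrite (eq_bigr (fun=> d)) ?sumr_const // => i iS.
  by rewrite LS // eqxx.
have := trace_cofactor_sum hG k; rewrite -/C tr -/d -cardS.
exact: mulrIn.
Qed.

End RankAndRange.

(** * From columns to rows; the sums as entries of matrix products *)

Section RowDuality.
Variables (R : realFieldType) (n : nat).
Local Notation H := (quat R).
Implicit Types (M G : 'M[H]_n) (i : 'I_n) (beta : {set 'I_n}).

(** Conjugation reverses both the order of the cycles and each cycle; passing to [s^-1] compensates
    for the latter. *)
Lemma rdet_conj beta M i : rdet beta M i = conjq (cdet beta (conjmx M) i).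
Proof.
rewrite conjq_sum [RHS](reindex_inj invg_inj).
have headsV s : cycle_heads beta i s^-1%g = cycle_heads beta i s.
  by congr (_ :: _); apply: other_heads_eq => [x|x _ _]; rewrite porbitV.
apply: eq_big => [s|s _].
  by apply/eq_subset => x; rewrite !inE (canF_eq (permKV s)) eq_sym.
rewrite headsV conjq_sign conjq_prod revK; congr (_ * _).
by apply: eq_bigr => x _; rewrite conj_cycle_prod conjmxK invgK.
Qed.

Lemma sum_hdetE G k :
  qhermitian G -> sum_hdet k G = real_quat (hermdet_sum G k).
Proof.
by move=> hG; rewrite real_quat_sum; apply: eq_bigr => beta _; apply: hdet_herm.
Qed.

Lemma sum_cdetE M k i b : sum_cdet k M i b = (cofactor_sum M k *m b) i 0.
Proof.
rewrite mulmx_suml summxE /sum_cdet big_mkcondr; apply: eq_bigr => beta _.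
case: ifPn => ib; first by rewrite cdet_repl_col_cofactor.
by rewrite mxE big1 // => q _; rewrite mxE (negPf ib) mul0r.
Qed.

Lemma cofactor_sum_herm G k : qhermitian G -> conjmx (cofactor_sum G k) =
  cofactor_sum G k.
Proof.
move=> hG; rewrite -[RHS](eq_bigr _ (fun beta _ => cofactor_mx_herm beta hG)).
by apply/matrixP => i j; rewrite !mxE !summxE conjq_sum;
  apply: eq_bigr => beta _; rewrite !mxE.
Qed.

Lemma sum_rdetE G k i (b : 'rV_n) : qhermitian G ->
  sum_rdet k G i b = (b *m cofactor_sum G k) 0 i.
Proof.
move=> hG; transitivity (conjq (sum_cdet k G i (conjmx b))).
  rewrite conjq_sum; apply: eq_bigr => beta _; rewrite rdet_conj;
    congr (conjq (cdet _ _ _)).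
  apply/matrixP => p q; rewrite !mxE; case: eqP => // _.
  by rewrite -[in RHS]hG !mxE.
by rewrite sum_cdetE -[in RHS](conjmxK b) -{2}(cofactor_sum_herm k hG)
  -conjmx_mul !mxE.
Qed.

End RowDuality.

(** * Powers of Hermitian matrices and the Drazin inverse *)

Section Drazin.
Variables (R : realFieldType) (n : nat).
Implicit Types (A X : 'M[quat R]_n).

Lemma qhermitianX A k : qhermitian A -> qhermitian (A ^+ k).
Proof.
move=> hA; elim: k => [|k IH].
  rewrite expr0; apply/matrixP => i j; rewrite !mxE eq_sym.
  by case: eqP => _; rewrite ?conjq1 ?conjq0.
rewrite /qhermitian exprS -[LHS]/(conjmx (A *m A ^+ k)) conjmx_mul.
by rewrite (hA : conjmx A = A) (IH : conjmx (A ^+ k) = A ^+ k) -exprS exprSr.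
Qed.

Lemma is_index_uniq A k l : is_index A k -> is_index A l -> k = l.
Proof.
by move=> [ka kmin] [la lmin]; apply/eqP; rewrite eqn_leq kmin ?lmin.
Qed.

(** Iterating [X = A X X] gives [X = A^m X^(m+1)], and [X] commutes with [A]. The factor [Y] lets
    [qrank_herm] for [A ^+ k.+1] act on [X] from either side. *)
Lemma drazin_spec A X k : is_index A k -> is_drazin A X ->
  [/\ A ^+ k.+1 *m X = A ^+ k, X *m A ^+ k.+1 = A ^+ k &
      exists Y, X = A ^+ k.+1 *m Y /\ X = Y *m A ^+ k.+1].
Proof.
move=> indA [l [indl AX XAX comm]]; have kl := is_index_uniq indA indl.
rewrite -{l indl}kl in AX.
have cX m : GRing.comm X (A ^+ m) by apply: commrX; apply/esym.
have XX : X = A * X * X by rewrite -[LHS]XAX -comm.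
have XE m : X = A ^+ m * X ^+ m.+1.
  elim: m => [|m IH]; first by rewrite mul1r.
  transitivity (A ^+ m * (A * X * X * X ^+ m)); first by rewrite -XX -exprS.
  by rewrite exprSr !exprS !mulrA.
split=> //; first by rewrite -AX; apply: cX.
exists (X ^+ k.+2); split; first exact: XE.
rewrite {1}(XE k.+1); apply/esym.
by have /commr_sym := commrX k.+2 (commr_sym (cX k.+1)).
Qed.

End Drazin.

(** * Cramer's rule for the Drazin inverse solution *)

Theorem theorem4p3 (R : realType) (n m : nat)
    (A : 'M[quat R]_n) (B : 'M[quat R]_m) (D X : 'M[quat R]_(n, m))
    (k1 k2 r1 r2 : nat)
    (hermA : qhermitian A) (hermB : qhermitian B)
    (indA : is_index A k1) (indB : is_index B k2)
    (rankA' : qrank (A ^+ k1.+1) = r1) (rankA : qrank (A ^+ k1) = r1)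
    (rankB' : qrank (B ^+ k2.+1) = r2) (rankB : qrank (B ^+ k2) = r2)
    (r1n : (1 <= r1 <= n)%N) (r2m : (1 <= r2 <= m)%N)
    (solX : is_drazin_solution A B D X) :
  let Dt : 'M[quat R]_(n, m) := A ^+ k1 *m D *m B ^+ k2 in
  let dB (j : 'I_m) : 'cV[quat R]_n :=
    \col_l sum_rdet r2 (B ^+ k2.+1) j (row l Dt) in
  let dA (i : 'I_n) : 'rV[quat R]_m :=
    \row_t sum_cdet r1 (A ^+ k1.+1) i (col t Dt) in
  let den : quat R :=
    sum_hdet r1 (A ^+ k1.+1) * sum_hdet r2 (B ^+ k2.+1) in
  den != 0 /\
  forall (i : 'I_n) (j : 'I_m),
    X i j = sum_cdet r1 (A ^+ k1.+1) i (dB j) / den /\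
    X i j = sum_rdet r2 (B ^+ k2.+1) j (dA i) / den.
Proof.
move=> Dt dB dA den; have [AD [BD [drA drB XE]]] := solX.
have [AX _ [U [ADU _]]] := drazin_spec indA drA.
have [_ XB [V [_ BDV]]] := drazin_spec indB drB.
have hGA := qhermitianX k1.+1 hermA; have hGB := qhermitianX k2.+1 hermB.
have [dA0 CGA] := qrank_herm hGA; have [dB0 CGB] := qrank_herm hGB.
rewrite rankA' in dA0 CGA; rewrite rankB' in dB0 CGB.
rewrite /den !sum_hdetE // -real_quatM.
set d := hermdet_sum _ _ * hermdet_sum _ _.
set GA := A ^+ k1.+1 in AX ADU hGA dA0 CGA d dA *.
set GB := B ^+ k2.+1 in XB BDV hGB dB0 CGB d dB *.
have d0 : real_quat d != 0 by rewrite real_quat_eq0 mulf_neq0.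
split=> // i j.
have DtE : Dt = GA *m X *m GB by rewrite /Dt XE !mulmxA AX -!mulmxA XB.
(* Cramer's rule on both sides at once. The two numerators are the entry [(i, j)] of this product
   under its two bracketings. *)
have CX : cofactor_sum GA r1 *m Dt *m cofactor_sum GB r2 =
    (real_quat d)%:M *m X.
  have -> : cofactor_sum GA r1 *m Dt =
      (real_quat (hermdet_sum GA r1))%:M *m X *m GB.
    by rewrite DtE XE ADU !mulmxA CGA.
  rewrite -!mulmxA (_ : X *m _ = X *m (real_quat (hermdet_sum GB r2))%:M).
    by rewrite mulmx_real_scalar mulmxA -scalar_mxM -real_quatM.
  rewrite XE BDV -!mulmxA; congr (_ *m (_ *m (_ *m _))).
  by rewrite (cofactor_sum_comm hGB) mulmxA (cofactor_sum_comm hGB)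
    mulmx_real_scalar -CGB.
have XijE x : x = (cofactor_sum GA r1 *m Dt *m cofactor_sum GB r2) i j ->
    X i j = x / real_quat d.
  by move=> ->; rewrite CX mul_scalar_mx mxE real_quatC mulrK.
split; apply: XijE.
  rewrite sum_cdetE -mulmxA !mxE; apply: eq_bigr => l _; congr (_ * _).
  by rewrite mxE sum_rdetE // -row_mul mxE.
rewrite sum_rdetE // !mxE; apply: eq_bigr => t _; congr (_ * _).
by rewrite mxE sum_cdetE colE mulmxA -colE mxE.
Qed.
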